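(* Let $p=2$ and let $P$ be a finite abelian $2$-group. Every perfect self-isometry of $\mathcal{O}(P\times A_4)$ is of the form $(J,I_{\sigma,\epsilon})$, i.e. $\theta\otimes\chi_j\mapsto J(\theta)\otimes I_{\sigma,\epsilon}(\chi_j)$ for $\theta\in\mathrm{Irr}(P)$, $1\le j\le 4$, where $J$ is a perfect self-isometry of $\mathcal{O}P$ induced by an $\mathcal{O}$-algebra automorphism of $\mathcal{O}P$, $\sigma\in S_4$ and $\epsilon\in\{\pm1\}$.
   Context: $(K,\mathcal{O},k)$ is a $2$-modular system with $k$ algebraically closed of characteristic $2$. Irreducible characters of $A_4$: $\chi_1$ trivial, $\chi_2,\chi_3$ the nontrivial linear characters with $\chi_2((123))=\omega$, $\chi_3((123))=\omega^2$ ($\omega$ a primitive cube root of unity), and $\chi_4$ of degree $3$. Set $\delta_1=\delta_2=\delta_3=1$, $\delta_4=-1$, and for $\sigma\in S_4$, $\epsilon\in\{\pm1\}$ define the isometry $I_{\sigma,\epsilon}:\mathbb{Z}\mathrm{Irr}(A_4)\to\mathbb{Z}\mathrm{Irr}(A_4)$ by $\chi_j\mapsto \epsilon\delta_j\delta_{\sigma(j)}\chi_{\sigma(j)}$. A perfect isometry is in the sense of Broué. *)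

(* Defs.v *)
From HB Require Import structures.
From mathcomp Require Import all_boot all_order all_algebra all_fingroup all_solvable all_field all_character vcharacter.
Set Implicit Arguments. Unset Strict Implicit. Unset Printing Implicit Defensive.
Import Order.TTheory GRing.Theory Num.Theory.
Local Open Scope ring_scope.

(** The valuation ring O, seen inside the algebraic complex numbers algC
    (where MathComp characters take their values): a valuation ring of algC
    containing the algebraic integers, whose maximal ideal contains p
    (i.e. 1/p is not in O).  This is O ∩ \bar{Q} for a p-modular system. *)
Definition padic_valuation_ring (p : nat) (O : {pred algC}) : Prop :=
  [/\ {subset Aint <= O},
      forall x y, x \in O -> y \in O -> x + y \in O,
      forall x y, x \in O -> y \in O -> x * y \in O,
      forall x, x != 0 -> x \in O \/ x^-1 \in O
    & (p%:R)^-1 \notin O].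

Definition broue_mu (gT hT : finGroupType) (G : {group gT}) (H : {group hT})
    (I : 'CF(G) -> 'CF(H)) (g : gT) (h : hT) : algC :=
  \sum_(i : Iirr G) 'chi_i (g^-1)%g * I 'chi_i h.

Definition perfect_isometry (p : nat) (O : {pred algC})
    (gT hT : finGroupType) (G : {group gT}) (H : {group hT})
    (I : {additive 'CF(G) -> 'CF(H)}) : Prop :=
  [/\ {in ('Z[irr G])%g, isometry I, to ('Z[irr H])%g},
      {in ('Z[irr H])%g, forall psi, exists2 phi, phi \in ('Z[irr G])%g & I phi = psi},
      forall g h, g \in G -> h \in H ->
        broue_mu I g h / #|('C_G[g])%g|%:R \in O /\ broue_mu I g h / #|('C_H[h])%g|%:R \in O
    & forall g h, g \in G -> h \in H -> broue_mu I g h != 0 ->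
        (p^'.-elt g)%g = (p^'.-elt h)%g].

(** J : Irr(P) -> Irr(P) (theta |-> 'chi_(J theta)) is induced by an
    O-algebra automorphism alpha of OP.  alpha is given on the basis P by
    alpha(g) = \sum_(h in P) a g h * h, with entries in O, unital,
    multiplicative, with an inverse matrix with entries in O; and
    'chi_(J theta) = theta o alpha (theta extended linearly to OP). *)
Definition induced_by_OP_automorphism (O : {pred algC}) (gT : finGroupType)
    (P : {group gT}) (J : Iirr P -> Iirr P) : Prop :=
  exists a : gT -> gT -> algC, exists b : gT -> gT -> algC,
  [/\ forall g h, g \in P -> h \in P -> a g h \in O /\ b g h \in O,
      forall h, h \in P -> a 1%g h = (h == 1%g)%:R,
      forall g g' k, g \in P -> g' \in P -> k \in P ->
        \sum_(h in P) a g h * a g' (h^-1 * k)%g = a (g * g')%g k,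
      forall g k, g \in P -> k \in P ->
        \sum_(h in P) a g h * b h k = (g == k)%:R
                   /\ \sum_(h in P) b g h * a h k = (g == k)%:R
    & forall (t : Iirr P) g, g \in P ->
        \sum_(h in P) a g h * 'chi_t h = 'chi_(J t) g].

Definition A4 : {group {perm 'I_4}} := Alt_group 'I_4.

(** The 3-cycle (1 2 3), i.e. 0 -> 1 -> 2 -> 0 on 'I_4. *)
Definition c123 : {perm 'I_4} :=
  (tperm (inord 1 : 'I_4) (inord 2) * tperm (inord 0 : 'I_4) (inord 1))%g.

(** Labeling chi_1..chi_4 of Irr(A4) (indices 0..3), omega a primitive
    cube root of unity. *)
Definition A4_labeling (omega : algC) (chiA : 'I_4 -> Iirr A4) : Prop :=
  [/\ 'chi_(chiA (inord 0)) = 1,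
      'chi_(chiA (inord 1)) \is a linear_char /\ 'chi_(chiA (inord 1)) c123 = omega,
      'chi_(chiA (inord 2)) \is a linear_char /\ 'chi_(chiA (inord 2)) c123 = omega ^+ 2
    & 'chi_(chiA (inord 3)) 1%g = 3].

Definition delta (j : 'I_4) : algC := if val j == 3%N then -1 else 1.

Lemma inord4_neq (a b : nat) : (a < 4)%N -> (b < 4)%N -> a != b -> (inord a : 'I_4) != inord b.
Proof. by move=> Ha Hb Hab; apply/eqP => /(congr1 val); rewrite /= !inordK //; apply/eqP. Qed.
Lemma c123_0 : c123 (inord 0) = inord 1.
Proof. by rewrite /c123 permM [tperm _ _ (inord 0)]tpermD ?inord4_neq // tpermL. Qed.
Lemma c123_1 : c123 (inord 1) = inord 2.
Proof. by rewrite /c123 permM [tperm _ _ (inord 1)]tpermL tpermD ?inord4_neq. Qed.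
Lemma c123_2 : c123 (inord 2) = inord 0.
Proof. by rewrite /c123 permM [tperm _ _ (inord 2)]tpermR tpermR. Qed.
Lemma c123_3 : c123 (inord 3) = inord 3.
Proof. by rewrite /c123 permM [tperm _ _ (inord 3)]tpermD ?inord4_neq // tpermD ?inord4_neq. Qed.
Lemma c123_in_A4 : c123 \in A4.
Proof. by rewrite /A4 /= Alt_even /c123 odd_permM !odd_tperm !inord4_neq. Qed.

(* Main.v *)
Require Import Defs.
From HB Require Import structures.
From mathcomp Require Import all_boot all_order all_algebra all_fingroup all_solvable all_field all_character vcharacter.
From mathcomp Require Import ring.
Import Order.TTheory GRing.Theory Num.Theory.
Local Open Scope ring_scope.

(** An isometry permutes the irreducible characters theta * chi_j up to sign.
    In the signed basis theta * (delta_j chi_j), a 2-regular y in A4 gives the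
    function reg_P * sum_j delta_j chi_j(y) chi_j, whose image vanishes on
    2-singular elements by separation.  Hence the coefficients of this image do
    not depend on theta and sum to zero over j; comparing y = 1 and y = (123)
    shows that the signed permutation maps the column Irr(P) * chi_j onto the
    column of a sigma(j), with a single global sign eps, so that
    I (theta * chi_j) is given by permutations J_j of Irr(P).

    Integrality of mu at (x, y), (x', t) with t an involution of A4, whose
    centralizer has order 4 |P|, says that sum_j delta_j chi_j(y) (J_j theta)(x')
    lies in 4 O for every y.  Combining y = t, (123), (132) gives
    3 (J_j theta)(x') + (J_4 theta)(x') in 4 O.  These values are 2-power roots
    of unity, so they coincide and all J_j equal one J.  Finally y = 1 and y = t
    give the integrality of |P|^-1 mu_J, the matrix of the automorphism of OP
    that induces J. *)

(** * Characters, centralizers and p-elements of a direct product *)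

Section DirectProduct.
Variables (gT hT : finGroupType) (G : {group gT}) (H : {group hT}).

(** [setX G H] is the internal direct product of the images of [G] and [H] under the two embeddings,
    so the parametrization for internal products applies after transport along these
    isomorphisms. *)
Lemma irr_setX :
  exists e : Iirr G * Iirr H -> Iirr (setX G H),
    bijective e /\
    forall i j, {in G & H, forall x y, 'chi_(e (i, j)) (x, y) = 'chi_i x * 'chi_j y}.
Proof.
have isoG : isom G (setX G [1 hT]%G) (restrm (subsetT G) (pairg1 hT)).
  by apply/isomP; rewrite injm_restrm ?injm_pairg1 // morphim_restrm morphim_pairg1 setIid.
have isoH : isom H (setX [1 gT]%G H) (restrm (subsetT H) (@pair1g gT hT)).
  by apply/isomP; rewrite injm_restrm ?injm_pair1g // morphim_restrm morphim_pair1g setIid.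
have GxH := setX_dprod G H.
exists (fun k => dprod_Iirr GxH (isom_Iirr isoG k.1, isom_Iirr isoH k.2)); split.
  pose h k := (isom_Iirr (isom_sym isoG) (inv_dprod_Iirr GxH k).1,
               isom_Iirr (isom_sym isoH) (inv_dprod_Iirr GxH k).2).
  exists h => [[i j]|k]; rewrite /h.
    by rewrite dprod_IirrK /= !isom_IirrK.
  by rewrite /= !isom_IirrKV -surjective_pairing inv_dprod_IirrK.
move=> i j x y Gx Hy; rewrite dprod_IirrE !isom_IirrE /=.
have -> : (x, y) = (pairg1 hT x * @pair1g gT hT y)%g.
  by apply/pair_eqP; rewrite /pair_eq /= mulg1 mul1g !eqxx.
by rewrite cfDprodE ?(cfIsomE isoG) ?(cfIsomE isoH) // inE /= ?Gx ?Hy group1.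
Qed.

Lemma cent1_setX x y : ('C_(setX G H)[(x, y)] = setX 'C_G[x] 'C_H[y])%g.
Proof.
apply/setP=> -[u v]; rewrite in_setX !in_setI in_setX /= andbACA; congr (_ && _).
by rewrite !cent1E xpair_eqE.
Qed.

Lemma p_elt_fst (pi : nat_pred) (u : gT * hT) : (pi.-elt u -> pi.-elt u.1)%g.
Proof. exact: (morph_p_elt (@fst_morphism gT hT) (in_setT u)). Qed.

Lemma p_elt_snd (pi : nat_pred) (u : gT * hT) : (pi.-elt u -> pi.-elt u.2)%g.
Proof. exact: (morph_p_elt (@snd_morphism gT hT) (in_setT u)). Qed.

Lemma p_elt_pair1 (pi : nat_pred) (y : hT) : (pi.-elt ((1, y) : gT * hT) = pi.-elt y)%g.
Proof.
apply/idP/idP => [/p_elt_snd //|].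
exact: (morph_p_elt (@pair1g_morphism gT hT) (in_setT y)).
Qed.

End DirectProduct.

(** * The four labels and their signs *)

Lemma ord4_cases (j : 'I_4) :
  [\/ j = inord 0, j = inord 1, j = inord 2 | j = inord 3].
Proof.
by case: j => [[|[|[|[|//]]]] lt_j4]; [apply: Or41 | apply: Or42 | apply: Or43 | apply: Or44];
  apply: val_inj; rewrite /= inordK.
Qed.

Lemma sum_ord4 (V : nmodType) (F : 'I_4 -> V) :
  \sum_j F j = F (inord 0) + F (inord 1) + F (inord 2) + F (inord 3).
Proof.
by rewrite !big_ord_recr big_ord0 /= add0r; congr (F _ + F _ + F _ + F _);
  apply: val_inj; rewrite /= inordK.
Qed.

Lemma delta_ord4 :
  (delta (inord 0) = 1) * (delta (inord 1) = 1) * (delta (inord 2) = 1)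
  * (delta (inord 3) = -1).
Proof. by rewrite /delta /= !inordK. Qed.

Lemma deltaK j : delta j * delta j = 1.
Proof. by rewrite /delta; case: ifP => _; rewrite ?mulrNN mulr1. Qed.

(** * The signed character table of the alternating group of degree 4 *)

Section A4Characters.
Variables (omega : algC) (chiA : 'I_4 -> Iirr A4).
Hypotheses (prim_omega : 3.-primitive_root omega) (labA : A4_labeling omega chiA).

Lemma omega_cubed : omega ^+ 3 = 1.
Proof. exact: prim_expr_order. Qed.

Lemma omega_neq1 : omega != 1.
Proof.
by apply/eqP => w1; have := eq_prim_root_expr prim_omega 1 0; rewrite expr1 expr0 w1 eqxx.
Qed.

Lemma omega_sum : 1 + omega + omega ^+ 2 = 0.
Proof.
apply: (mulfI (_ : omega - 1 != 0)); first by rewrite subr_eq0 omega_neq1.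
by rewrite mulr0 -(subrr 1) -{3}omega_cubed; ring.
Qed.

Lemma omega_neq0 : omega != 0.
Proof. by apply: contra_eq_neq omega_cubed => ->; rewrite expr0n /= eq_sym oner_eq0. Qed.

Lemma omega_neq_sq : omega != omega ^+ 2.
Proof.
by rewrite expr2 -{1}[omega]mulr1 (inj_eq (mulfI omega_neq0)) eq_sym omega_neq1.
Qed.

Lemma card_A4 : #|A4| = 12.
Proof.
have := @card_Alt 'I_4; rewrite card_ord /= => /(_ isT) /eqP.
by rewrite -[4`!]/(2 * 12)%N eqn_pmul2l // => /eqP.
Qed.

Lemma chiA_inj : injective chiA.
Proof.
have [chi0 [lin1 c1] [lin2 c2] deg3] := labA.
have d0 : 'chi_(chiA (inord 0)) 1%g = 1 by rewrite chi0 cfun11.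
have c0 : 'chi_(chiA (inord 0)) c123 = 1 by rewrite chi0 cfun1E c123_in_A4.
have d1 := lin_char1 lin1; have d2 := lin_char1 lin2.
have n13 : (1 : algC) != 3 by rewrite (eqr_nat _ 1 3).
have nw := omega_neq1; have nww := omega_neq_sq.
have nw2 : omega ^+ 2 != 1.
  by apply/eqP => E; case/eqP: omega_neq1; rewrite -omega_cubed exprS E mulr1.
(* One invariant separates the four labels: degree 3 is marked by 0, and the linear characters keep
   their values 1, omega, omega^2, all nonzero and distinct. *)
pose f (k : Iirr A4) : algC := if 'chi_k 1%g == 3 then 0 else 'chi_k c123.
have f0 : f (chiA (inord 0)) = 1 by rewrite /f d0 (negPf n13).
have f1 : f (chiA (inord 1)) = omega by rewrite /f d1 (negPf n13).
have f2 : f (chiA (inord 2)) = omega ^+ 2 by rewrite /f d2 (negPf n13).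
have f3 : f (chiA (inord 3)) = 0 by rewrite /f deg3 eqxx.
move=> i j /(congr1 f) /eqP.
case: (ord4_cases i) => ->; case: (ord4_cases j) => -> //;
  rewrite ?f0 ?f1 ?f2 ?f3 => E; move: E nw nww nw2 omega_neq0;
  rewrite ?oner_eq0 ?expf_eq0 //= 1?eq_sym ?oner_eq0 ?expf_eq0 //= => -> //.
Qed.

(** The squares of the labelled degrees already sum to 1 + 1 + 1 + 9 = 12, the group order, which
    leaves no room for a further irreducible character. *)
Lemma chiA_bij : bijective chiA.
Proof.
apply: inj_card_bij chiA_inj _; rewrite card_ord leqNgt card_ord; apply/negP=> lt4N.
have [chi0 [lin1 c1] [lin2 c2] deg3] := labA.
have /subsetPn[k _ kNA] : ~~ ([set: Iirr A4] \subset chiA @: setT).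
  apply: contraL lt4N => /subset_leq_card.
  by rewrite (card_imset _ chiA_inj) !cardsT !card_ord leqNgt.
have : \sum_(i in chiA @: setT) 'chi_i 1%g ^+ 2 + 'chi_k 1%g ^+ 2 <= #|A4|%:R.
  rewrite -irr_sum_square [X in _ <= X](bigID [in chiA @: setT]) /= lerD2l.
  rewrite (bigD1 k) //= lerDl sumr_ge0 // => i _.
  by rewrite exprn_ge0 // ltW // irr1_gt0.
rewrite big_imset /=; last by move=> i j _ _; apply: chiA_inj.
rewrite (eq_bigl xpredT) => [|i]; last by rewrite inE.
rewrite sum_ord4 chi0 cfun11 (lin_char1 lin1) (lin_char1 lin2) deg3 card_A4.
rewrite !expr1n (_ : 1 + 1 + 1 + 3 ^+ 2 = 12%:R); last by ring.
by rewrite gerDl => /le_gtF; rewrite exprn_gt0 // irr1_gt0.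
Qed.

(** In the basis delta_j chi_j all four values at an involution are 1, and I_{sigma,eps} is a
    permutation times one global sign. *)
Definition sgchi (j : 'I_4) (y : {perm 'I_4}) : algC := delta j * 'chi_(chiA j) y.

Lemma sum_irr_A4 (F : Iirr A4 -> algC) : \sum_i F i = \sum_j F (chiA j).
Proof. by rewrite (reindex chiA) //; apply: onW_bij chiA_bij. Qed.

Lemma sgchi_1 j : sgchi j 1%g = if j == inord 3 then -3 else 1.
Proof.
have [chi0 [lin1 c1] [lin2 c2] deg3] := labA.
case: (ord4_cases j) => ->; rewrite /sgchi ?delta_ord4 -val_eqE /= !inordK //=.
- by rewrite chi0 cfun11 mulr1.
- by rewrite (lin_char1 lin1) mulr1.
- by rewrite (lin_char1 lin2) mulr1.
by rewrite deg3 mulN1r.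
Qed.

(** The two classes of 3-cycles share one case; [w] tells them apart. *)
Variant A4_element_spec (y : {perm 'I_4}) : Prop :=
| A4_trivial of y = 1%g
| A4_involution of (forall j, sgchi j y = 1) & #|('C_A4[y])%g| = 4 & ~~ (2%N^'.-elt y)%g
| A4_3cycle w of (w == omega) || (w == omega ^+ 2) &
    sgchi (inord 0) y = 1 & sgchi (inord 1) y = w & sgchi (inord 2) y = w ^+ 2 &
    sgchi (inord 3) y = 0 & (2%N^'.-elt y)%g.

(** No computation with permutations: w = chi_2(y) is a cube root of unity and chi_3(y) = w^2.
    Column orthogonality of y with 1 then gives chi_4(y), and of y with itself the centralizer
    order: -1 and 4 if w = 1, otherwise 0 and 3. *)
Lemma A4_elementP y : y \in A4 -> A4_element_spec y.
Proof.
move=> Ay; have [->|y_neq1] := eqVneq y 1%g; first exact: A4_trivial.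
have [chi0 [lin1 c1] [lin2 c2] deg3] := labA.
have v0 : 'chi_(chiA (inord 0)) y = 1 by rewrite chi0 cfun1E Ay.
(* The group of linear characters has order 3 and is separated by the value at c123. *)
have lin_eq1 (xi : 'CF(A4)) : xi \is a linear_char -> xi c123 = 1 -> xi = 1.
  move=> lin_xi; have /irrP[i Ei] := lin_char_irr lin_xi.
  have [g _ gK] := chiA_bij; rewrite -(gK i) in Ei; move: lin_xi; rewrite Ei.
  case: (ord4_cases (g i)) => -> // lin_i.
  - by rewrite c1 => w1; case/eqP: omega_neq1.
  - rewrite c2 => w1; case/eqP: omega_neq1.
    by rewrite -omega_cubed exprS w1 mulr1.
  by have := lin_char1 lin_i; rewrite deg3 => /eqP; rewrite (eqr_nat _ 3 1).
have /(congr1 (fun xi : 'CF(A4) => xi y)) : 'chi_(chiA (inord 1)) ^+ 3 = 1.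
  by apply: lin_eq1; rewrite ?rpredX // expS_cfunE // c1 omega_cubed.
rewrite expS_cfunE // cfun1E Ay mulr1n.
have /(congr1 (fun xi : 'CF(A4) => xi y)) : 'chi_(chiA (inord 2)) * 'chi_(chiA (inord 1)) = 1.
  by apply: lin_eq1; rewrite ?rpredM // cfunE c1 c2 -exprSr omega_cubed.
rewrite cfunE cfun1E Ay mulr1n.
set w := 'chi_(chiA (inord 1)) y => E2 w3.
have v2 : 'chi_(chiA (inord 2)) y = w ^+ 2.
  by rewrite -[LHS]mulr1 -w3 exprS mulrA E2 mul1r.
have sum0 : 1 + w + w ^+ 2 + 3 * 'chi_(chiA (inord 3)) y = 0.
  have := second_orthogonality_relation y (group1 A4).
  rewrite class1G inE (negPf y_neq1) mulr0n sum_irr_A4 sum_ord4.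
  rewrite chi0 cfun11 (lin_char1 lin1) (lin_char1 lin2) deg3 rmorph1 !mulr1 cfun1E Ay v2.
  by rewrite conjC_nat mulrC => ->.
have normw : w * w^* = 1 by rewrite -normCK normC_lin_char ?expr1n.
have cardC : #|('C_A4[y])%g|%:R = 3 + `|'chi_(chiA (inord 3)) y| ^+ 2 :> algC.
  have := second_orthogonality_relation y Ay.
  rewrite class_refl mulr1n sum_irr_A4 sum_ord4 v0 v2 -/w rmorph1 rmorphXn /= -exprMn normw.
  by rewrite normCK => <-; rewrite expr1n mulr1; congr (_ + _); ring.
have order_dvd : (#[y]%g %| #|('C_A4[y])%g|)%N by rewrite order_dvdG // inE Ay cent1id.
have sg0 : sgchi (inord 0) y = 1 by rewrite /sgchi delta_ord4 mul1r.
have sg1 : sgchi (inord 1) y = w by rewrite /sgchi delta_ord4 mul1r.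
have sg2 : sgchi (inord 2) y = w ^+ 2 by rewrite /sgchi delta_ord4 mul1r.
have [w1|w_neq1] := eqVneq w 1.
  have v3 : 'chi_(chiA (inord 3)) y = -1.
    apply: (mulfI (_ : 3 != 0 :> algC)); first by rewrite pnatr_eq0.
    apply: (addrI (1 + w + w ^+ 2)); rewrite sum0 w1; ring.
  have card4 : #|('C_A4[y])%g| = 4%N.
    by apply/eqP; rewrite -(eqr_nat algC) cardC v3 normrN1 expr1n; apply/eqP; ring.
  apply: A4_involution => // [j|].
    case: (ord4_cases j) => ->; rewrite ?sg0 ?sg1 ?sg2 ?w1 ?expr1n //.
    by rewrite /sgchi delta_ord4 v3 mulN1r opprK.
  rewrite card4 in order_dvd.
  rewrite -order_gt1 in y_neq1; rewrite /p_elt p'natE // negbK.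
  by move: y_neq1 order_dvd; case: #[y]%g => [|[|[|[|[|n]]]]] // _ /dvdn_leq // /(_ isT).
have wsum : 1 + w + w ^+ 2 = 0.
  apply: (mulfI (_ : w - 1 != 0)); first by rewrite subr_eq0.
  by rewrite mulr0 -(subrr 1) -{3}w3; ring.
have v3 : 'chi_(chiA (inord 3)) y = 0.
  by move/eqP: sum0; rewrite wsum add0r mulf_eq0 pnatr_eq0 /= => /eqP.
have card3 : #|('C_A4[y])%g| = 3%N.
  by apply/eqP; rewrite -(eqr_nat algC) cardC v3 normr0 expr0n addr0.
apply: (@A4_3cycle y w) => //.
- have [|i /= Ei] := prim_rootP prim_omega (x := w) _; first by [].
  move: Ei w_neq1; case: i => [[|[|[|//]]]] _ /= ->; rewrite ?expr0 ?expr1 ?eqxx ?orbT //.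
- by rewrite /sgchi v3 mulr0.
by rewrite /p_elt (pnat_dvd order_dvd) ?card3.
Qed.

End A4Characters.

(** * Isometries as signed permutations of irreducible characters *)

Lemma sum_pair (V : nmodType) (K L : finType) (F : K * L -> V) :
  \sum_k F k = \sum_i \sum_j F (i, j).
Proof. by rewrite pair_bigA; apply: eq_bigr => -[]. Qed.

(** A generalized character of norm 1 is an irreducible character up to sign; images of distinct
    characters stay orthogonal, which gives injectivity. *)
Lemma isometry_signed_irr (gT hT : finGroupType) (G : {group gT}) (H : {group hT})
    (I : 'CF(G) -> 'CF(H)) :
  {in ('Z[irr G])%g, isometry I, to ('Z[irr H])%g} ->
  exists (s : Iirr G -> bool) (p : Iirr G -> Iirr H),
    injective p /\ forall i, I 'chi_i = (-1) ^+ s i *: 'chi_(p i).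
Proof.
case=> isoI ZI.
have /fin_all_exists[f fE] i : exists sp : bool * Iirr H, I 'chi_i == (-1) ^+ sp.1 *: 'chi_sp.2.
  have [|b [j Ij]] := vchar_norm1P (ZI _ (irr_vchar i)).
    by rewrite isoI ?irr_vchar // cfdot_irr eqxx.
  by exists (b, j); rewrite Ij.
exists (fun i => (f i).1), (fun i => (f i).2); split=> [i j Eij|i]; last exact/eqP.
have := isoI _ _ (irr_vchar i) (irr_vchar j).
rewrite (eqP (fE i)) (eqP (fE j)) Eij cfdotZl cfdotZr !cfdot_irr eqxx mulr1.
case: eqP => // _ /eqP; rewrite mulf_eq0 conjC_eq0 !signr_eq0 //.
Qed.

(** * Fourier inversion, and automorphisms of the group algebra of an abelian group *)

Section Orthogonality.
Variables (gT : finGroupType) (G : {group gT}).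

Lemma sum_irr_mul_inv (i j : Iirr G) :
  \sum_(x in G) 'chi_i x * 'chi_j x^-1%g = #|G|%:R * (i == j)%:R.
Proof. by rewrite -(first_orthogonality_relation i j) mulVKf ?neq0CG. Qed.

Lemma sum_lin_comb_irr_inv (X : Iirr G -> algC) (j : Iirr G) :
  \sum_(x in G) (\sum_i X i * 'chi_i x) * 'chi_j x^-1%g = #|G|%:R * X j.
Proof.
under eq_bigr do rewrite mulr_suml.
rewrite exchange_big (bigD1 j) //= [X in _ + X]big1 ?addr0 => [|i i'j].
  under eq_bigr do rewrite -mulrA.
  by rewrite -mulr_sumr sum_irr_mul_inv eqxx mulr1 mulrC.
under eq_bigr do rewrite -mulrA.
by rewrite -mulr_sumr sum_irr_mul_inv (negPf i'j) !mulr0.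
Qed.

Lemma irr_lin_indep (X : Iirr G -> algC) :
  {in G, forall x, \sum_i X i * 'chi_i x = 0} -> forall i, X i = 0.
Proof.
move=> X0 i; apply: (mulfI (neq0CG G)); rewrite mulr0 -sum_lin_comb_irr_inv.
by rewrite big1 // => x Gx; rewrite X0 // mul0r.
Qed.

Hypothesis abG : abelian G.

Lemma abelian_sum_irr (x y : gT) : x \in G -> y \in G ->
  \sum_i 'chi[G]_i x * 'chi_i y^-1%g = #|G|%:R * (x == y)%:R.
Proof.
move=> Gx Gy; under eq_bigr do rewrite irr_inv.
rewrite second_orthogonality_relation //.
have -> : 'C_G[x]%g = G by apply/setIidPl; rewrite sub_cent1 (subsetP abG).
rewrite -mulr_natr; congr (_ * (_ %:R)); congr nat_of_bool.
apply/imsetP/eqP => [[z Gz ->]|->]; last by exists 1%g; rewrite ?group1 ?conjg1.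
by apply/conjg_fixP/commgP; apply: (centsP abG).
Qed.

Lemma abelian_lin_irr (i : Iirr G) : 'chi_i \is a linear_char.
Proof. by move/char_abelianP: abG. Qed.

(** A function on an abelian group supported at 1 is a multiple of the regular character. *)
Lemma lin_comb_irr_const (X : Iirr G -> algC) :
  {in G, forall x, x != 1%g -> \sum_i X i * 'chi_i x = 0} -> forall i j, X i = X j.
Proof.
move=> X0 i j.
have X1 k : #|G|%:R * X k = \sum_l X l.
  rewrite -sum_lin_comb_irr_inv (bigD1 (1%g : gT)) //= [X in _ + X]big1 ?addr0.
    rewrite invg1 lin_char1 ?abelian_lin_irr // mulr1.
    by apply: eq_bigr => l _; rewrite lin_char1 ?abelian_lin_irr // mulr1.
  by move=> x /andP[Gx x1]; rewrite X0 // mul0r.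
by apply: (mulfI (neq0CG G)); rewrite !X1.
Qed.

(** Broué's two-variable character of the sign-free isometry that permutes Irr(G) by [J]. *)
Definition mu_fun (J : Iirr G -> Iirr G) (x y : gT) : algC :=
  \sum_i 'chi_i x^-1%g * 'chi_(J i) y.

Lemma sum_mu_fun J i y : \sum_(x in G) 'chi_i x * mu_fun J x y = #|G|%:R * 'chi_(J i) y.
Proof.
under eq_bigr do rewrite mulr_sumr.
rewrite exchange_big (bigD1 i) //= [X in _ + X]big1 ?addr0 => [|j j'i].
  under eq_bigr do rewrite mulrA.
  by rewrite -mulr_suml sum_irr_mul_inv eqxx mulr1.
under eq_bigr do rewrite mulrA.
by rewrite -mulr_suml sum_irr_mul_inv eq_sym (negPf j'i) mulr0 mul0r.
Qed.

(** The matrix of the automorphism is mu_J / |G| with its arguments swapped. Each identity required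
    of it is checked after pairing with every irreducible character. *)
Lemma induced_by_OP_automorphism_mu_fun (O : {pred algC}) (J : Iirr G -> Iirr G) :
    injective J -> {in G &, forall x y, mu_fun J x y / #|G|%:R \in O} ->
  induced_by_OP_automorphism O J.
Proof.
move=> injJ OJ; have nzG := neq0CG G.
pose a g h : algC := mu_fun J h g / #|G|%:R.
(* This is the matrix [a] of the inverse of [J], rewritten through [J] so that the hypothesis gives
   its integrality. *)
pose b g h : algC := mu_fun J g^-1%g h^-1%g / #|G|%:R.
have a_char i g : g \in G -> \sum_(h in G) a g h * 'chi_i h = 'chi_(J i) g.
  move=> Gg; apply: (mulfI nzG); rewrite -sum_mu_fun mulr_sumr.
  by apply: eq_bigr => h _; rewrite /a mulrC mulrAC divfK // mulrC.
have b_char i g : g \in G -> \sum_(h in G) b g h * 'chi_(J i) h = 'chi_i g.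
  move=> Gg; apply: (mulfI nzG); rewrite mulr_sumr.
  under eq_bigr do rewrite /b mulrC mulrAC divfK // /mu_fun invgK mulr_suml.
  rewrite exchange_big (bigD1 i) //= [X in _ + X]big1 ?addr0 => [|j j'i].
    under eq_bigr do rewrite -mulrA [X in _ * X]mulrC.
    by rewrite -mulr_sumr sum_irr_mul_inv eqxx mulr1 mulrC.
  under eq_bigr do rewrite -mulrA [X in _ * X]mulrC.
  by rewrite -mulr_sumr sum_irr_mul_inv (inj_eq injJ) eq_sym (negPf j'i) !mulr0.
(* Fourier coefficients determine a function on an abelian group. *)
have char_inj (F F' : gT -> algC) :
    (forall i : Iirr G, \sum_(h in G) F h * 'chi_i h = \sum_(h in G) F' h * 'chi_i h) ->
  {in G, F =1 F'}.
  move=> eqF k Gk; apply: (mulfI nzG).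
  have recover (D : gT -> algC) :
      #|G|%:R * D k = \sum_i (\sum_(h in G) D h * 'chi_i h) * 'chi[G]_i k^-1%g.
    under eq_bigr do rewrite mulr_suml.
    rewrite exchange_big (bigD1 k) //= [X in _ + X]big1 ?addr0 => [|h /andP[Gh h'k]].
      under eq_bigr do rewrite -mulrA.
      by rewrite -mulr_sumr abelian_sum_irr // eqxx mulr1 mulrC.
    under eq_bigr do rewrite -mulrA.
    by rewrite -mulr_sumr abelian_sum_irr // (negPf h'k) !mulr0.
  by rewrite (recover F) (recover F'); apply: eq_bigr => i _; rewrite eqF.
have delta_char g i : g \in G -> \sum_(h in G) (g == h)%:R * 'chi_i h = 'chi[G]_i g.
  move=> Gg; rewrite (bigD1 g) //= eqxx mul1r big1 ?addr0 // => h /andP[_ h'g].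
  by rewrite eq_sym (negPf h'g) mul0r.
exists a, b; split.
- by move=> g h Gg Gh; rewrite /a /b !OJ ?groupV.
- apply: char_inj => i; rewrite a_char ?group1 //.
  under [RHS]eq_bigr do rewrite eq_sym.
  by rewrite delta_char ?group1 // !lin_char1 ?abelian_lin_irr.
- move=> g g' k Gg Gg'; move: k.
  apply: char_inj => i; rewrite a_char ?groupM // lin_charM ?abelian_lin_irr //.
  under eq_bigr do rewrite mulr_suml.
  rewrite exchange_big /= -!a_char // mulr_suml; apply: eq_bigr => h Gh.
  rewrite mulr_sumr (reindex_inj (mulgI h)) /=.
  apply: eq_big => [k|k]; first by rewrite groupMl.
  rewrite groupMl // mulKg => Gk.
  by rewrite (lin_charM (abelian_lin_irr i)) // mulrACA.
- move=> g k Gg; move: k => k Gk; split; move: k Gk.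
    apply: char_inj => i; rewrite delta_char //.
    under eq_bigr do rewrite mulr_suml.
    rewrite exchange_big /=.
    (* [b_char] only evaluates characters in the form ['chi_(J _)], hence the preimage of [i]. *)
    have [J' _ JK] := injF_bij injJ; rewrite -(JK i).
    under eq_bigr do [under eq_bigr do rewrite -mulrA; rewrite -mulr_sumr].
    rewrite -[RHS]a_char //; apply: eq_bigr => h Gh; rewrite b_char //.
  apply: char_inj => i; rewrite delta_char //.
  under eq_bigr do rewrite mulr_suml.
  rewrite exchange_big /= -[RHS]b_char //; apply: eq_bigr => h Gh.
  by under eq_bigr do rewrite -mulrA; rewrite -mulr_sumr a_char.
- by move=> i g Gg; apply: a_char.
Qed.

End Orthogonality.

(* A 2-power root of unity r <> 1 has a power equal to -1, so that r - 1 divides 2. *)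
Lemma root2_congr1_mod4 (O : {pred algC}) (n : nat) (r z : algC) :
  padic_valuation_ring 2 O -> r ^+ (2 ^ n) = 1 -> z \in O -> r - 1 = 4 * z -> r = 1.
Proof.
case=> AintO OD OM _ half'O rn Oz Er.
have Aint_r : r \in Aint.
  by apply: (Aint_unity_root (n := (2 ^ n)%N)); rewrite ?expn_gt0 //; apply/unity_rootP.
elim: n rn => [|n IHn]; first by rewrite expr1.
rewrite expnSr exprM => /eqP; rewrite sqrf_eq1 => /orP[/eqP/IHn //|/eqP rn].
case/negP: half'O.
(* With r^(2^n) = -1, the geometric sum gives -2 = (r - 1) q = 4 z q, so 1/2 = - z q would lie in
   [O]. *)
set q := \sum_(i < 2 ^ n) r ^+ i.
have Eq : -2 = 4 * z * q by rewrite -Er -subrX1 rn; ring.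
have -> : 2%:R^-1 = -1 * (z * q) :> algC.
  have nz2 : 2 != 0 :> algC by rewrite pnatr_eq0.
  apply: (mulfI nz2); rewrite divff //; apply: (mulfI nz2).
  by rewrite mulr1 -[LHS]opprK Eq; ring.
apply: (OM); first by rewrite AintO // rpredN rpred1.
by apply: OM => //; rewrite AintO // rpred_sum // => i _; rewrite rpredX.
Qed.

(** * The columns Irr(P) * chi_j and their permutations *)

Section Columns.
Variables (omega : algC) (chiA : 'I_4 -> Iirr A4).
Hypotheses (prim_omega : 3.-primitive_root omega) (labA : A4_labeling omega chiA).
Local Notation sg := (sgchi chiA).

Lemma sgchi_c123 :
  [/\ sg (inord 0) c123 = 1, sg (inord 1) c123 = omega & sg (inord 2) c123 = omega ^+ 2].
Proof.
have [chi0 [_ c1] [_ c2] _] := labA.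
by rewrite /sgchi !delta_ord4 !mul1r chi0 c1 c2 cfun1E c123_in_A4.
Qed.

Lemma sgchi_3 y : y \in A4 -> (2%N^'.-elt y)%g -> y != 1%g -> sg (inord 3) y = 0.
Proof.
move=> Ay y2 y1.
by case: (A4_elementP _ _ prim_omega labA _ Ay) y2 y1 => [->|_ _ /negPf->|]; rewrite ?eqxx.
Qed.

Lemma c123_neq1 : c123 != 1%g.
Proof.
apply/eqP => E; have /eqP := c123_0; rewrite E perm1.
by apply/negP; apply: inord4_neq.
Qed.

Lemma c123_2'elt : (2%N^'.-elt c123)%g.
Proof.
case: (A4_elementP _ _ prim_omega labA _ c123_in_A4) => // [E|E _ _].
  by have := c123_neq1; rewrite E eqxx.
have [_ E1 _] := sgchi_c123; have := omega_neq1 _ prim_omega.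
by rewrite -E1 E eqxx.
Qed.

Lemma sgchi_c123_inv :
  [/\ sg (inord 0) c123^-1%g = 1, sg (inord 1) c123^-1%g = omega ^+ 2
    & sg (inord 2) c123^-1%g = omega].
Proof.
have [chi0 [l1 c1] [l2 c2] _] := labA.
rewrite /sgchi !delta_ord4 !mul1r chi0 (lin_charV l1) ?(lin_charV l2) ?c123_in_A4 // c1 c2.
rewrite cfun1E groupV c123_in_A4.
have w3 := omega_cubed _ prim_omega; have w0 := omega_neq0 _ prim_omega.
split=> //; first by apply: (mulfI w0); rewrite divff // -exprS.
by apply: (mulfI (expf_neq0 2 w0)); rewrite divff ?expf_neq0 // -exprSr.
Qed.

Lemma A4_involution_exists :
  exists t, [/\ t \in A4, forall j, sg j t = 1, #|('C_A4[t])%g| = 4 & ~~ (2%N^'.-elt t)%g].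
Proof.
have [t At ot] : {t | t \in A4 & #[t]%g = 2} by apply: Cauchy; rewrite ?card_A4.
exists t; case: (A4_elementP _ _ prim_omega labA _ At) => [E|sgt Ct t2|w _ _ _ _ _].
- by move: ot; rewrite E order1.
- by [].
by rewrite /p_elt ot.
Qed.

Lemma sgchi_lin_indep (X : 'I_4 -> algC) :
  {in A4, forall y, \sum_j X j * sg j y = 0} -> forall j, X j = 0.
Proof.
move=> X0 j; have [g gK Kg] := chiA_bij _ _ prim_omega labA.
pose Y i := X (g i) * delta (g i).
have Y0 : forall i, Y i = 0.
  apply: irr_lin_indep => y Ay; rewrite -[RHS](X0 y Ay) (sum_irr_A4 _ _ prim_omega labA).
  by apply: eq_bigr => i _; rewrite /Y gK mulrA.
have /eqP := Y0 (chiA j); rewrite /Y gK mulf_eq0 => /orP[/eqP // | /eqP d0].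
by have := deltaK j; rewrite d0 mul0r => /esym/eqP; rewrite oner_eq0.
Qed.

(* Up to sign, the rows of the signed table restricted to {1, c123} are distinct. *)
Lemma signed_sgchi_inj (b b' : bool) (i i' : 'I_4) :
  (-1) ^+ b * sg i 1%g = (-1) ^+ b' * sg i' 1%g ->
  (-1) ^+ b * sg i c123 = (-1) ^+ b' * sg i' c123 -> b = b' /\ i = i'.
Proof.
have nz x : (-1) ^+ x != 0 :> algC by rewrite signr_eq0.
have n31 : (3 == 1 :> algC) = false by rewrite (eqr_nat _ 3 1).
have sgn_inj (x y : bool) : (-1) ^+ x = (-1) ^+ y :> algC -> x = y by move/signr_inj.
have nw := omega_neq1 _ prim_omega; have nww := omega_neq_sq _ prim_omega.
have nw2 : omega ^+ 2 != 1.
  by apply/eqP => E; case/eqP: nw; rewrite -(omega_cubed _ prim_omega) exprS E mulr1.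
have [c0 c1 c2] := sgchi_c123.
rewrite !(sgchi_1 _ _ labA) => E1.
have E3 : (i == inord 3) = (i' == inord 3).
  move/(congr1 Num.norm): E1; rewrite !normrMsign.
  by case: ifP; case: ifP => // _ _;
    rewrite ?(normrN, normr1, normr_nat) => /eqP; rewrite ?[1 == _]eq_sym n31.
move: E1; rewrite E3; case: ifP => [/eqP i'3|i'3] E1.
  move=> _; split; last by rewrite i'3; apply/eqP; rewrite E3 i'3.
  by apply: sgn_inj; apply: mulIf E1; rewrite oppr_eq0 pnatr_eq0.
have Eb : b = b' by apply: sgn_inj; rewrite !mulr1 in E1.
rewrite Eb => /(mulfI (nz _)) E; split=> //; move: E.
rewrite i'3 in E3; move: E3 i'3.
case: (ord4_cases i) => ->; rewrite ?eqxx //; case: (ord4_cases i') => ->; rewrite ?eqxx //;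
  rewrite ?c0 ?c1 ?c2 => _ _ /eqP; rewrite ?(negPf nw) ?(negPf nww) ?(negPf nw2) //;
  by rewrite eq_sym ?(negPf nw) ?(negPf nww) ?(negPf nw2).
Qed.

Variables (gT : finGroupType) (P : {group gT}).
Hypothesis abP : abelian P.

(* The coefficients of the image of the projective class function reg_P * sg(-)(y)
   are constant along Irr P, because this image vanishes off the 2-regular elements. *)
Lemma signed_perm_columns (s : Iirr P * 'I_4 -> bool) (p : Iirr P * 'I_4 -> Iirr P * 'I_4) :
    injective p ->
    (forall y x' y', y \in A4 -> x' \in P -> y' \in A4 -> (2%N^'.-elt y)%g ->
       (x' != 1%g) || ~~ (2%N^'.-elt y')%g ->
     \sum_k (-1) ^+ s k * sg k.2 y * ('chi_(p k).1 x' * sg (p k).2 y') = 0) ->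
  exists (sigma : {perm 'I_4}) (eps : bool),
    forall k, (p k).2 = sigma k.2 /\ s k = eps.
Proof.
move=> injp sep; have [q pK qK] := injF_bij injp.
(* The coefficient of the target character (t, a) in the image, for the source value [y]. *)
pose W y t a := (-1) ^+ s (q (t, a)) * sg (q (t, a)).2 y.
have sepW y x' y' : y \in A4 -> x' \in P -> y' \in A4 -> (2%N^'.-elt y)%g ->
    (x' != 1%g) || ~~ (2%N^'.-elt y')%g ->
  \sum_a (\sum_t W y t a * 'chi[P]_t x') * sg a y' = 0.
  move=> Ay Px Ay' y2 xy; rewrite -[RHS](sep y x' y') //.
  rewrite (reindex q) /=; last by apply: onW_bij; exists p.
  rewrite sum_pair exchange_big; apply: eq_bigr => a _.
  by rewrite mulr_suml; apply: eq_bigr => t _; rewrite qK /W /= !mulrA.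
(* For x != 1 the inner sums vanish for every [a], by independence of the rows of the signed table;
   what remains is supported at 1 in [P]. *)
have W_const y t t' a : y \in A4 -> (2%N^'.-elt y)%g -> W y t a = W y t' a.
  move=> Ay y2; apply: (lin_comb_irr_const _ _ abP (fun t => W y t a)) => x Px x1.
  apply: (sgchi_lin_indep (fun a => \sum_i W y i a * 'chi_i x)) => y' Ay'.
  by apply: sepW => //; rewrite x1.
pose t0 : Iirr P := 0; pose tau a := (q (t0, a)).2; pose sa a := s (q (t0, a)).
(* The constant values at 1 and at [c123] recover both the sign and the source column. *)
have q_col t a : s (q (t, a)) = sa a /\ (q (t, a)).2 = tau a.
  apply: signed_sgchi_inj; first by apply: (W_const 1%g); rewrite ?group1 // /p_elt order1.
  by apply: (W_const c123); rewrite ?c123_in_A4 ?c123_2'elt.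
pose g i := (p (t0, i)).2.
have gK : cancel g tau.
  move=> i; rewrite /g; case E: (p (t0, i)) => [t a] /=.
  by have [_ <-] := q_col t a; rewrite -E pK.
have tauK : cancel tau g by apply: (inj_can_sym gK); exact: (can_inj (canF_sym gK)).
have p_col k : (p k).2 = g k.2 /\ s k = sa (g k.2).
  case E: (p k) => [t a] /=.
  have Ek : q (t, a) = k by rewrite -E pK.
  by have := q_col t a; rewrite Ek => -[-> ->]; rewrite tauK.
(* Evaluation at (1, y') with y' an involution, where every signed character of the second factor
   equals 1. *)
have sum_signs : \sum_i (-1) ^+ sa (g i) * sg i 1%g = 0.
  have [y' [Ay' sgy' _ y'2]] := A4_involution_exists.
  have := sepW 1%g 1%g y' (group1 _) (group1 _) Ay'.
  rewrite y'2 orbT /p_elt order1 => /(_ isT isT).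
  have E a : (\sum_t W 1%g t a * 'chi[P]_t 1%g) * sg a y' =
      #|Iirr P|%:R * ((-1) ^+ sa a * sg (tau a) 1%g).
    rewrite sgy' mulr1 -sum1_card natr_sum mulr_suml; apply: eq_bigr => t _.
    rewrite lin_char1 ?abelian_lin_irr // mulr1 mul1r /W.
    by have [-> ->] := q_col t a.
  under eq_bigr do rewrite E.
  rewrite -mulr_sumr => /eqP; rewrite mulf_eq0 pnatr_eq0 card_ord /= => /eqP.
  rewrite (reindex g) /=; last by apply: onW_bij; exists tau.
  by under eq_bigr do rewrite gK.
(* The signed degrees are 1, 1, 1, -3, so in sign bits b0 + b1 + b2 = 3 b3, which forces all four
   bits to agree. *)
have sa_const i : sa (g i) = sa (g (inord 3)).
  move: sum_signs; rewrite sum_ord4 !(sgchi_1 _ _ labA) eqxx.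
  rewrite -!val_eqE /= !inordK //= !mulr1.
  set b0 := sa (g (inord 0)); set b1 := sa (g (inord 1)).
  set b2 := sa (g (inord 2)); set b3 := sa (g (inord 3)).
  rewrite !signrE -!mul2n ![(2 * _)%:R]natrM => E.
  have : (b0 + b1 + b2)%N%:R = (3 * b3)%N%:R :> algC.
    apply: (mulfI (_ : 2 != 0 :> algC)); first by rewrite pnatr_eq0.
    rewrite natrM !natrD; apply/eqP; rewrite -subr_eq0 -oppr_eq0 -E; apply/eqP; ring.
  move/eqP; rewrite eqr_nat; case: (ord4_cases i) => ->; rewrite -/b0 -/b1 -/b2 -/b3;
    by move: (b0) (b1) (b2) (b3) => [] [] [] [].
exists (perm (can_inj gK)), (sa (g (inord 3))) => k.
by rewrite permE; have [-> ->] := p_col k; rewrite sa_const.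
Qed.

(** The integrality hypothesis is that of mu at an involution of the second factor, where the target
    signed characters equal 1 and the centralizer has order 4 |P|. *)
Lemma columns_agree (O : {pred algC}) (J : 'I_4 -> Iirr P -> Iirr P) :
    padic_valuation_ring 2 O -> (2%N.-group P)%g -> (forall j, injective (J j)) ->
    (forall x x' y, x \in P -> x' \in P -> y \in A4 ->
       \sum_j sg j y * mu_fun _ P (J j) x x' / (4 * #|P|%:R) \in O) ->
  (forall j, J j =1 J (inord 3)) /\ induced_by_OP_automorphism O (J (inord 3)).
Proof.
move=> valO P2 injJ int; have [AintO OD OM _ _] := valO.
have [t [At sgt _ _]] := A4_involution_exists.
have [w3 wsum] := (omega_cubed _ prim_omega, omega_sum _ prim_omega).
have [cA VA] : c123 \in A4 /\ c123^-1%g \in A4 by rewrite groupV c123_in_A4.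
have nzP := neq0CG P; have nz4 : 4 != 0 :> algC by rewrite pnatr_eq0.
have Osum (T : finType) (A : {pred T}) (F : T -> algC) :
    (forall u, u \in A -> F u \in O) -> \sum_(u in A) F u \in O.
  move=> OF; elim/big_ind: _ => //; by rewrite AintO ?rpred0.
have ON z : z \in O -> - z \in O.
  by move=> Oz; rewrite -mulN1r OM // AintO // rpredN rpred1.
have Oomega : omega \in O.
  by apply: AintO; apply: (Aint_unity_root (n := 3)) => //; apply/unity_rootP.
have OnatM n z : z \in O -> n%:R * z \in O by move=> Oz; rewrite OM // AintO // rpred_nat.
split; last first.
  apply: induced_by_OP_automorphism_mu_fun => // x x' Px Px'.
  (* The signed rows at [t] and at 1 differ only in the last entry, by 1 - (-3) = 4, which cancels
     the 4 in the denominator and isolates the last column. *)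
  have := OD _ _ (int x x' t Px Px' At) (ON _ (int x x' 1%g Px Px' (group1 _))).
  rewrite -!mulr_suml !sum_ord4 !sgt !(sgchi_1 _ _ labA) eqxx -!val_eqE /= !inordK //=.
  by congr (_ \in O); field.
move=> j i; apply/irr_inj/cfun_inP=> x' Px'.
pose zeta k := 'chi_(J k i) x'.
(* Summing against chi_i(x) over [P] isolates the image of chi_i in each column; the resulting |P|
   cancels and the factor 4 survives. *)
have int_zeta y : y \in A4 -> exists2 z, z \in O & \sum_k sg k y * zeta k = 4 * z.
  move=> Ay.
  exists (\sum_(x in P) 'chi_i x * \sum_j sg j y * mu_fun _ P (J j) x x' / (4 * #|P|%:R)).
    by apply: Osum => x Px; rewrite OM ?int // AintO ?Aint_irr.
  under [X in _ = _ * X]eq_bigr do rewrite mulr_sumr.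
  rewrite [X in _ = _ * X]exchange_big mulr_sumr; apply: eq_bigr => k _.
  rewrite (eq_bigr (fun x => sg k y / (4 * #|P|%:R) * ('chi_i x * mu_fun _ P (J k) x x'))).
    by rewrite -mulr_sumr sum_mu_fun /zeta; field.
  by move=> x _; ring.
have [z1 Oz1 E1] := int_zeta t At.
have [z2 Oz2 E2] := int_zeta c123 cA.
have [z3 Oz3 E3] := int_zeta c123^-1%g VA.
have [s0 s1 s2] := sgchi_c123; have [v0 v1 v2] := sgchi_c123_inv.
have s3 : sg (inord 3) c123 = 0 by rewrite sgchi_3 ?c123_2'elt ?c123_neq1.
have v3 : sg (inord 3) c123^-1%g = 0.
  by rewrite sgchi_3 ?eq_invg1 ?c123_neq1 // /p_elt orderV; apply: c123_2'elt.
rewrite sum_ord4 !sgt !mul1r in E1.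
rewrite sum_ord4 s0 s1 s2 s3 mul1r mul0r addr0 in E2.
rewrite sum_ord4 v0 v1 v2 v3 mul1r mul0r addr0 in E3.
(* Weights 1, omega, omega^2 on the relations at [t], [c123] and its inverse are chosen so that 1 +
   omega + omega^2 = 0 kills the other two linear columns. *)
have [z Oz Ez] : exists2 z, z \in O & 3 * zeta j + zeta (inord 3) = 4 * z.
  have Ow2 : omega ^+ 2 \in O by rewrite expr2 OM.
  case: (ord4_cases j) => ->.
  - exists (z1 + z2 + z3); rewrite ?OD // !mulrDr -E1 -E2 -E3.
    by rewrite -[LHS]addr0 -(mul0r (zeta (inord 1) + zeta (inord 2))) -wsum; ring.
  - exists (z1 + omega ^+ 2 * z2 + omega * z3).
      by rewrite !OD // OM.
    rewrite !mulrDr ![4 * (_ * _)]mulrCA -E1 -E2 -E3.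
    apply/esym/eqP; rewrite -subr_eq0; apply/eqP.
    transitivity ((1 + omega + omega ^+ 2) * (zeta (inord 0) + zeta (inord 2))
      + (omega ^+ 3 - 1) * (2 * zeta (inord 1) + omega * zeta (inord 2))); first by ring.
    by rewrite wsum w3 subrr !mul0r addr0.
  - exists (z1 + omega * z2 + omega ^+ 2 * z3).
      by rewrite !OD // OM.
    rewrite !mulrDr ![4 * (_ * _)]mulrCA -E1 -E2 -E3.
    apply/esym/eqP; rewrite -subr_eq0; apply/eqP.
    transitivity ((1 + omega + omega ^+ 2) * (zeta (inord 0) + zeta (inord 1))
      + (omega ^+ 3 - 1) * (2 * zeta (inord 2) + omega * zeta (inord 1))); first by ring.
    by rewrite wsum w3 subrr !mul0r addr0.
  by exists (zeta (inord 3)); [rewrite AintO ?Aint_irr | ring].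
have lin k : 'chi_(J k i) \is a linear_char by apply: abelian_lin_irr.
have zeta_inv k : (zeta k)^-1 = 'chi_(J k i) x'^-1%g by rewrite lin_charV.
have zeta_neq0 k : zeta k != 0 by rewrite lin_char_neq0.
have [n cardP] : exists n, #|P| = (2 ^ n)%N.
  by case/p_natP: P2 => n ->; exists n.
have zeta_pow k : zeta k ^+ (2 ^ n) = 1.
  by rewrite -lin_charX // -cardP expg_cardG // lin_char1.
(* From 3 zeta_j + zeta_3 = 4 z (indices from 0) follows zeta_j - zeta_3 = 4 (zeta_j - z), hence the
   witness. *)
have := @root2_congr1_mod4 O n (zeta j / zeta (inord 3)) ((zeta j - z) / zeta (inord 3)) valO.
rewrite exprMn exprVn !zeta_pow invr1 mulr1 => /(_ erefl) root1.
have : zeta j / zeta (inord 3) = 1.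
  apply: root1.
    rewrite OM // ?OD ?ON //; first by rewrite AintO ?Aint_irr.
    by rewrite zeta_inv AintO ?Aint_irr.
  rewrite mulrA mulrBr -Ez -[X in _ - X](divff (zeta_neq0 (inord 3))) -mulrBl.
  by congr (_ / _); ring.
by move/divr1_eq.
Qed.

End Columns.

(** * Perfect self-isometries of the product with A4 *)

Theorem theorem3p4 (gT : finGroupType) (P : {group gT}) (O : {pred algC})
  (omega : algC) (chiA : 'I_4 -> Iirr A4)
  (I : {additive 'CF(setX P A4) -> 'CF(setX P A4)}) :
  padic_valuation_ring 2 O ->
  abelian P -> (2.-group P)%g ->
  3.-primitive_root omega -> A4_labeling omega chiA ->
  perfect_isometry 2 O I ->
  exists J : Iirr P -> Iirr P, exists sigma : {perm 'I_4}, exists eps : bool,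
    induced_by_OP_automorphism O J /\
    forall (i : Iirr (setX P A4)) (t : Iirr P) (j : 'I_4),
      (forall x y, x \in P -> y \in A4 -> 'chi_i (x, y) = 'chi_t x * 'chi_(chiA j) y) ->
      forall x y, x \in P -> y \in A4 ->
        I 'chi_i (x, y) =
          (-1) ^+ eps * delta j * delta (sigma j) * ('chi_(J t) x * 'chi_(chiA (sigma j)) y).
Proof.
move=> valO abP P2 prim_omega labA [isoI _ integral separation].
have [AintO _ OM _ _] := valO.
have [e [e_bij eE]] := irr_setX _ _ P A4.
pose E (k : Iirr P * 'I_4) := e (k.1, chiA k.2).
have E_bij : bijective E.
  apply: (bij_comp e_bij); have [g gK Kg] := chiA_bij _ _ prim_omega labA.
  by exists (fun k => (k.1, g k.2)) => -[t j] /=; rewrite ?gK ?Kg.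
have EE k x y : x \in P -> y \in A4 -> 'chi_(E k) (x, y) = 'chi_k.1 x * 'chi_(chiA k.2) y.
  exact: eE.
have [E' EK E'K] := E_bij.
have [s0 [p0 [p0_inj I0]]] := isometry_signed_irr _ _ _ _ _ isoI.
pose p k := E' (p0 (E k)).
have p_inj : injective p.
  by move=> k l /(can_inj E'K)/p0_inj/(can_inj EK).
(* The sign of [I] in the signed basis: the delta of the source and that of the target are
   absorbed. *)
pose s k := s0 (E k) (+) (val k.2 == 3%N) (+) (val (p k).2 == 3%N).
have deltaE j : delta j = (-1) ^+ (val j == 3%N) by rewrite /delta; case: ifP.
have IE k x y : x \in P -> y \in A4 -> I 'chi_(E k) (x, y) =
    (-1) ^+ s k * delta k.2 * ('chi_(p k).1 x * sgchi chiA (p k).2 y).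
  move=> Px Ay; rewrite I0 cfunE -{1}[p0 _]E'K EE // -/(p k) /sgchi !deltaE /s !signr_addb.
  set a := (-1) ^+ (val k.2 == _); set b := (-1) ^+ (val (p k).2 == _).
  have aa : a * a = 1 by rewrite -expr2 sqrr_sign.
  have bb : b * b = 1 by rewrite -expr2 sqrr_sign.
  transitivity ((-1) ^+ s0 (E k) * (a * a) * (b * b) * ('chi_(p k).1 x * 'chi_(chiA (p k).2) y)).
    by rewrite aa bb !mulr1.
  by move: ((-1) ^+ s0 (E k)) a b {aa bb} => c a b; ring.
(* Taking y^-1 as argument cancels the inverse inside mu, so that [y] itself indexes the signed
   table. *)
have muE x y x' y' : x \in P -> y \in A4 -> x' \in P -> y' \in A4 ->
    broue_mu I (x, y^-1)%g (x', y') =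
    \sum_k 'chi_k.1 x^-1%g *
      ((-1) ^+ s k * sgchi chiA k.2 y * ('chi_(p k).1 x' * sgchi chiA (p k).2 y')).
  move=> Px Ay Px' Ay'; rewrite /broue_mu (reindex E) /=; last exact: onW_bij.
  apply: eq_bigr => k _; rewrite IE //.
  have -> : (x, y^-1)^-1%g = (x^-1, y)%g by congr pair; rewrite invgK.
  by rewrite EE ?groupV // /sgchi; move: ((-1) ^+ s k) => c; ring.
have [sigma [eps p_col]] : exists (sigma : {perm 'I_4}) (eps : bool),
    forall k, (p k).2 = sigma k.2 /\ s k = eps.
  apply: (signed_perm_columns _ _ prim_omega labA _ _ abP) => // y x' y' Ay Px' Ay' y2 h_sing.
  (* (1, y^-1) is 2-regular and (x', y') is 2-singular because [P] is a 2-group, so separation makes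
     mu vanish. *)
  transitivity (broue_mu I (1, y^-1)%g (x', y')).
    rewrite muE //; apply: eq_bigr => k _.
    by rewrite invg1 lin_char1 ?abelian_lin_irr // mul1r.
  apply/eqP; apply: contraT => /separation.
  rewrite !in_setX /= group1 groupV Ay Px' Ay' => /(_ isT isT).
  rewrite p_elt_pair1 /p_elt orderV -/(p_elt _ y) y2 => /esym h2.
  case/norP: h_sing; rewrite negbK; split.
    have : (2%N.-elt x')%g by apply: mem_p_elt P2 _.
    by move/pnat_1/(_ (p_elt_fst _ _ _ _ h2)); rewrite /= => /eqP; rewrite order_eq1.
  by rewrite negbK (p_elt_snd _ _ _ _ h2).
pose J j t := (p (t, j)).1.
have pE t j : p (t, j) = (J j t, sigma j).
  by rewrite [LHS]surjective_pairing (p_col _).1.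
have J_inj j : injective (J j).
  move=> t t' Et; have : p (t, j) = p (t', j) by rewrite !pE Et.
  by move/p_inj => -[].
have [J_const indJ] : (forall j, J j =1 J (inord 3)) /\ induced_by_OP_automorphism O (J (inord 3)).
  apply: (columns_agree _ _ prim_omega labA _ _ abP _ _ valO P2 J_inj) => x x' y Px Px' Ay.
  have [t [At sgt Ct _]] := A4_involution_exists _ _ prim_omega labA.
  have [] := integral (x, y^-1)%g (x', t) _ _; rewrite ?in_setX /= ?Px ?Px' ?groupV ?Ay ?At // => _.
  rewrite muE // cent1_setX cardsX Ct.
  have -> : 'C_P[x']%g = P by apply/setIidPl; rewrite sub_cent1 (subsetP abP).
  (* Multiplying by the global sign removes it from mu. *)
  move/(OM ((-1) ^+ eps)); rewrite AintO ?rpredX ?rpredN ?rpred1 // => /(_ isT).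
  congr (_ \in O); rewrite natrM [X in _ / X]mulrC mulrA mulr_sumr; rewrite mulr_suml.
  rewrite sum_pair exchange_big; apply: eq_bigr => j _ /=.
  rewrite /mu_fun mulr_sumr mulr_suml; apply: eq_bigr => u _.
  rewrite (p_col _).2 pE /= sgt mulr1; congr (_ / _).
  transitivity (((-1) ^+ eps * (-1) ^+ eps) * (sgchi chiA j y * ('chi_u x^-1%g * 'chi_(J j u) x'))).
    by move: ((-1) ^+ eps) => c; ring.
  by rewrite -expr2 sqrr_sign mul1r.
exists (J (inord 3)), sigma, eps; split=> // i t j chi_iE x y Px Ay.
have -> : i = E (t, j).
  apply/irr_inj/cfun_inP=> -[u v] /setXP[Pu Av].
  by rewrite chi_iE // EE.
by rewrite IE // (p_col _).2 pE /= J_const /sgchi; move: ((-1) ^+ eps) => c; ring.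
Qed.
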